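(* Let $\gamma$ be a composition of $n$. The image under the operator $\blacktriangledown$ of each $\gamma$-Schur function in the parameter $1/t$, $\mathbf{R}^{(\gamma)}_\alpha(A;1/t)$ with $\alpha\le\gamma$, is ribbon Schur positive, up to a global sign. More precisely, $$\blacktriangledown\left(\mathbf{R}^{(\gamma)}\left(A;\frac1t\right)\right)=\left(\bigotimes_{i\in D(\gamma)}\begin{bmatrix}1&t^i\end{bmatrix}\ \otimes\bigotimes_{i\notin D(\gamma)}\begin{bmatrix}0&-q^{n-i}t^i\\1&t^i+q^{n-i}\end{bmatrix}\right)\mathbf{R}(A),$$ where $i$ ranges over $\{1,\ldots,n-1\}$ and the entries of the column vectors are ordered by $\phi_\gamma$.
   Context: A composition $\alpha=(\alpha_1,\ldots,\alpha_{l(\alpha)})$ of $n$ (written $\alpha\models n$) is a sequence of positive integers with sum $n$; $l(\alpha)$ is its length. Its descent set is $D(\alpha)=\{\alpha_1,\alpha_1+\alpha_2,\ldots,\alpha_1+\cdots+\alpha_{l(\alpha)-1}\}\subseteq\{1,\ldots,n-1\}$; this gives a bijection between compositions of $n$ and subsets of $\{1,\ldots,n-1\}$. Refinement order: $\alpha\le\beta$ iff $D(\beta)\subseteq D(\alpha)$. Complement: $D(\alpha^c)=\{1,\ldots,n-1\}\setminus D(\alpha)$. Reverse: $\overleftarrow{\alpha}=(\alpha_{l(\alpha)},\ldots,\alpha_1)$. Conjugate: $\alpha'=\overleftarrow{\alpha^c}$. For compositions of $n$: $c(\alpha,\beta)=\sum_{i\in D(\alpha)\cap D(\beta)}i$,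 $n(\alpha)=\sum_{i\in D(\alpha)}i$. $\mathbf{Sym}=\mathbb{C}(q,t)\langle\mathbf{h}_1,\mathbf{h}_2,\ldots\rangle$ is the free associative algebra; $\mathbf{h}_\alpha(A)=\mathbf{h}_{\alpha_1}\cdots\mathbf{h}_{\alpha_{l(\alpha)}}$; ribbon Schur functions: $\mathbf{R}_\alpha(A)=\sum_{\beta\ge\alpha}(-1)^{l(\alpha)-l(\beta)}\mathbf{h}_\beta(A)$. Modified non-commutative Macdonald polynomials: $\widetilde{\mathbf{H}}_\alpha(A;q,t)=\sum_{\beta\models n}t^{c(\alpha,\beta)}q^{c(\alpha',\overleftarrow{\beta})}\mathbf{R}_\beta(A)$ for $\alpha\models n$; these form a basis. The operator $\blacktriangledown$ is the $\mathbb{C}(q,t)$-linear operator with $\blacktriangledown(\widetilde{\mathbf{H}}_\alpha(A;q,t))=t^{n(\alpha)}q^{n(\alpha')}\widetilde{\mathbf{H}}_\alpha(A;q,t)$ for all $\alpha$. For compositions $\alpha\le\gamma$ of $n$, the $\gamma$-Schur (or $\gamma$-ribbon Schur) function is $$\mathbf{R}_\alpha^{(\gamma)}(A;t)=\sum_{\substack{\beta\ge\alpha\\ D(\alpha)\setminus D(\beta)\subseteq D(\gamma)}}t^{c(\alpha,\beta^c)}\mathbf{R}_\beta(A),$$ and $\mathbf{R}_\alpha^{(\gamma)}(A;1/t)$ is obtained by replacing $t$ by $1/t$. ''Ribbon Schur positive up to a global sign'' means that, after multiplying by a single sign $\pm1$ (depending on $\alpha$), all coefficients in the basis $\{\mathbf{R}_\beta(A)\}_{\beta\models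 n}$ are polynomials in $q,t$ with nonnegative integer coefficients. Ordering: write $D(\gamma)=\{i_1<\cdots<i_k\}$ and $D(\gamma^c)=\{j_1<\cdots<j_{n-1-k}\}$, let $\sigma_\gamma$ be the permutation of $\{1,\ldots,n-1\}$ with $\sigma_\gamma(i_s)=s$ and $\sigma_\gamma(j_r)=k+r$, and set $\phi_\gamma(\alpha)=\sum_{i\in D(\alpha)}2^{\sigma_\gamma(i)-1}$. $\mathbf{R}^{(\gamma)}(A;1/t)$ denotes the column vector of the $\mathbf{R}_\alpha^{(\gamma)}(A;1/t)$, $\alpha\le\gamma$, listed by increasing $\phi_\gamma(\alpha)$, and $\mathbf{R}(A)$ the column vector of all $\mathbf{R}_\beta(A)$, $\beta\models n$, listed by increasing $\phi_\gamma(\beta)$; $\blacktriangledown$ is applied entrywise. Tensor product convention: $B\otimes C=[c_{ij}B]_{i,j}$ (block matrix with blocks $c_{ij}B$). The tensor factors indexed by $i\in D(\gamma)$ come first, then those indexed by $i\notin D(\gamma)$, in each group in increasing order of $i$. *)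

(* Defs.v *)
From HB Require Import structures.
From mathcomp Require Import all_boot all_order all_algebra.
From mathcomp Require Import reals.
From mathcomp Require Import complex mxtens.
From mathcomp.multinomials Require Import monalg.

Set Implicit Arguments.
Unset Strict Implicit.
Unset Printing Implicit Defensive.

Import GRing.Theory.

Record composition (n : nat) := Composition {
  parts :> seq nat;
  _ : all (fun k => 0 < k) parts && (sumn parts == n)
}.

HB.instance Definition _ n := [isSub for @parts n].
HB.instance Definition _ n := [Countable of composition n by <:].

Section CompositionFinite.
Variable n : nat.

Let code (a : composition n) : n.-bseq 'I_n.+1 := insub_bseq n (map inord a).
Let decode (b : n.-bseq 'I_n.+1) : option (composition n) :=
  insub (map val b).

Lemma composition_codeK : pcancel code decode.
Proof.
move=> a; rewrite /code /decode.
have := valP a; rewrite /= => /andP[pos_a /eqP sum_a].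
have le_sum (s : seq nat) k : k \in s -> k <= sumn s.
  elim: s => //= x s IH; rewrite inE => /predU1P[->|/IH h]; first exact: leq_addr.
  exact: leq_trans h (leq_addl _ _).
have size_a : size a <= n.
  apply: leq_trans (_ : sumn a <= n); last by rewrite sum_a.
  elim: (parts a) pos_a => //= x s IH /andP[x0 /IH h].
  by rewrite -addn1 addnC leq_add.
have -> : map val (insub_bseq n (map inord a : seq 'I_n.+1)) = a :> seq nat.
  rewrite /insub_bseq insubdK; last by rewrite unfold_in /= size_map.
  rewrite -map_comp; apply: map_id_in => k /le_sum; rewrite sum_a => le_kn /=.
  by rewrite inordK.
exact: valK.
Qed.

HB.instance Definition _ : isFinite (composition n) := PCanIsFinite composition_codeK.
End CompositionFinite.

Section Compositions.
Variable n : nat.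
Implicit Types a b g : composition n.

Definition desc a : {set 'I_n} :=
  [set i : 'I_n | [exists k : 'I_(size a),
                    (0 < k) && (i == sumn (take k a) :> nat)]].

(* The default a of odflt is never reached: see desc_compl below. *)
Definition compl a : composition n :=
  odflt a [pick b : composition n | desc b == [set i : 'I_n | 0 < i] :\: desc a].

Lemma rev_composition_proof a :
  all (fun k => 0 < k) (rev a) && (sumn (rev a) == n).
Proof. by rewrite all_rev sumn_rev; case: a. Qed.

Definition rev_comp a : composition n := Composition (rev_composition_proof a).

Definition conj_comp a : composition n := rev_comp (compl a).

(* finer a b is the refinement order a <= b, with b the coarser one. *)
Definition finer a b : bool := desc b \subset desc a.

Definition cstat a b : nat := \sum_(i in desc a :&: desc b) i.
Definition nstat a : nat := \sum_(i in desc a) i.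

(* enum lists a {set 'I_n} in increasing order. *)
Definition sigma g (i : 'I_n) : nat :=
  (index i (enum (desc g) ++ enum (desc (compl g)))).+1.

Definition phi g a : nat := \sum_(i in desc a) 2 ^ (sigma g i).-1.

Definition by_phi g (P : pred (composition n)) : seq (composition n) :=
  sort (fun a b => phi g a <= phi g b) (enum P).

End Compositions.

Section DescentBijection.
Variable n : nat.
Implicit Types a b g : composition n.

Let gaps := pairmap (fun x y => y - x).

Lemma sum_gaps x s k : path ltn x s -> k <= size s ->
  x + sumn (take k (gaps x s)) = nth 0 (x :: s) k.
Proof.
elim: s x k => [|y s IH] x [|k] //=; rewrite ?addn0 //.
move=> /andP[lt_xy ps] le_k.
by rewrite addnA subnKC ?(ltnW lt_xy) // IH.
Qed.

Lemma gaps_scan x s :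
  gaps x (scanl addn x s) = s.
Proof. by elim: s x => //= y s IH x; rewrite IH addKn. Qed.

Lemma nth_scan x s k : k <= size s ->
  nth 0 (x :: scanl addn x s) k = x + sumn (take k s).
Proof.
elim: s x k => [|y s IH] x [|k] //=; rewrite ?addn0 // => le_k.
by rewrite IH // addnA.
Qed.

Lemma desc_pos a i : i \in desc a -> 0 < i.
Proof.
rewrite inE => /existsP[k /andP[k0 /eqP->]].
case: a k k0 => s /= /andP[pos _] [k lt_k] /= k0.
by case: s pos k k0 lt_k => //= x s /andP[x0 _] [|k] //= _ _; rewrite addn_gt0 x0.
Qed.

Lemma desc_sub a : desc a \subset [set i : 'I_n | 0 < i].
Proof. by apply/subsetP => i /desc_pos; rewrite inE. Qed.

Lemma scan_path x s : all (fun k => 0 < k) s -> path ltn x (scanl addn x s).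
Proof.
by elim: s x => //= y s IH x /andP[y0 /IH ->]; rewrite -addn1 leq_add2l y0.
Qed.

Lemma mem_desc a (i : 'I_n) :
  (i \in desc a) = ((i : nat) \in scanl addn 0 a).
Proof.
case: a => s ps; rewrite inE /=; apply/existsP/idP => /=.
  case=> k /andP[k0 /eqP ->].
  rewrite -[sumn _]add0n -nth_scan 1?ltnW //.
  by case: k k0 => -[|k] //= lt_k _; rewrite mem_nth // size_scanl ltnW.
move=> /(nthP 0)[k]; rewrite size_scanl => lt_k Hk.
have Ek : sumn (take k.+1 s) = i by rewrite -[LHS]add0n -nth_scan.
case/andP: ps => _ /eqP sum_s.
have lt_k1 : k.+1 < size s.
  rewrite ltn_neqAle lt_k andbT; apply/eqP => e.
  by move: Ek; rewrite e take_size sum_s => e'; have := ltn_ord i; rewrite -e' ltnn.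
by exists (Ordinal lt_k1); rewrite /= Ek.
Qed.

Lemma desc_inj : injective (@desc n).
Proof.
move=> a b eqD; apply: val_inj; rewrite /=.
rewrite -(gaps_scan 0 a) -(gaps_scan 0 b); congr gaps.
have srt (c : composition n) : sorted ltn (scanl addn 0 (parts c)).
  by apply: path_sorted (scan_path 0 _); case: c => ? /= /andP[].
apply: (irr_sorted_eq ltn_trans ltnn) => // x.
have gtn_out (c : composition n) : x \in scanl addn 0 (parts c) -> x <= n.
  case/(nthP 0) => k; rewrite size_scanl => lt_k <-.
  rewrite -[X in X <= n]/(nth 0 (0 :: _) k.+1) (nth_scan 0 lt_k) add0n.
  case: c lt_k => s /= /andP[_ /eqP sum_s] _.
  have : sumn (take k.+1 s) <= sumn s.
    by rewrite -[X in _ <= sumn X](cat_take_drop k.+1 s) sumn_cat leq_addr.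
  by rewrite [X in _ <= X]sum_s.
have n_in (c : composition n) : (n \in scanl addn 0 (parts c)) = (0 < n).
  case: c => s /= /andP[pos /eqP sum_s].
  rewrite -sum_s; case: s pos {sum_s} => [//|y s /andP[y0 _]].
  rewrite [RHS]addn_gt0 y0; apply/(nthP 0); exists (size s).
    by rewrite size_scanl.
  rewrite -[LHS]/(nth 0 (0 :: _) (size s).+1) (nth_scan 0 (leqnn (size (y :: s)))).
  by rewrite take_size.
case: (ltngtP x n) => [lt_xn|gt_xn|->].
- by move/setP/(_ (Ordinal lt_xn)): eqD; rewrite !mem_desc.
- by apply/idP/idP => /gtn_out; rewrite leqNgt gt_xn.
- by rewrite !n_in.
Qed.

Lemma desc_onto (S : {set 'I_n}) : S \subset [set i : 'I_n | 0 < i] ->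
  exists a, desc a = S.
Proof.
move=> sub; case: (posnP n) => [n0|n_gt0].
  have p : all (fun k => 0 < k) [::] && (sumn [::] == n) by rewrite n0.
  exists (Composition p); apply/setP => -[i lt_i].
  by exfalso; rewrite n0 in lt_i.
pose s := rcons [seq val i | i <- enum S] n.
have srt : sorted ltn [seq val i | i <- enum S].
  apply: (subseq_sorted ltn_trans _ (iota_ltn_sorted 0 n)).
  by rewrite -val_enum_ord map_subseq // enumT filter_subseq.
have pth : path ltn 0 s.
  have lt_s x : x \in [seq val i | i <- enum S] -> 0 < x < n.
    case/mapP => i; rewrite mem_enum => iS ->; rewrite ltn_ord andbT.
    by move/subsetP/(_ _ iS): sub; rewrite inE.
  rewrite /s rcons_path; apply/andP; split.
    rewrite path_sortedE; last exact: ltn_trans.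
    by rewrite srt andbT; apply/allP => x /lt_s/andP[].
  have := mem_last 0 [seq val i | i <- enum S].
  by rewrite inE => /predU1P[->//|/lt_s/andP[]].
have pos x r : path ltn x r -> all (fun k => 0 < k) (gaps x r).
  by elim: r x => //= y r IH x /andP[xy /IH ->]; rewrite subn_gt0 xy.
have sumg : sumn (gaps 0 s) = n.
  have := sum_gaps pth (leqnn _); rewrite add0n.
  rewrite -{1}(size_pairmap (fun x y => y - x) 0 s) take_size => ->.
  by rewrite -[size s]/(size (0 :: s)).-1 nth_last /= last_rcons.
have p : all (fun k => 0 < k) (gaps 0 s) && (sumn (gaps 0 s) == n).
  by rewrite pos // sumg eqxx.
exists (Composition p); apply/setP => i; rewrite mem_desc /=.
have -> : scanl addn 0 (gaps 0 s) = s.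
  elim: (s) (0) (pth) => //= y r IH x /andP[xy pr].
  by rewrite subnKC ?(ltnW xy) // IH.
rewrite /s mem_rcons inE ltn_eqF //= mem_map ?mem_enum //; exact: val_inj.
Qed.

Lemma desc_compl a : desc (compl a) = [set i : 'I_n | 0 < i] :\: desc a.
Proof.
rewrite /compl; case: pickP => [b /eqP //|none].
have [b Db] := desc_onto (subsetDl [set i : 'I_n | 0 < i] (desc a)).
by have := none b; rewrite Db eqxx.
Qed.

Lemma card_finer g :
  #|[pred a | finer a g]| = 2 ^ #|desc (compl g)|.
Proof.
pose f a := desc a :\: desc g.
have f_inj : {in [pred a | finer a g] &, injective f}.
  move=> a b; rewrite !inE /finer => ga gb eq_f; apply: desc_inj.
  by rewrite -(setID (desc a) (desc g)) -(setID (desc b) (desc g)) -/(f a) eq_f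
             !(setIidPr _).
rewrite -card_powerset -(card_in_imset f_inj); apply: eq_card => S.
rewrite powersetE desc_compl; apply/imsetP/idP => [[a _ ->]|sub_S].
  exact: setSD (desc_sub a).
have [|a Da] := @desc_onto (desc g :|: S).
  by rewrite subUset desc_sub (subset_trans sub_S) ?subsetDl.
exists a; rewrite ?inE /finer /f Da ?subsetUl // setDUl setDv set0U.
by move: sub_S; rewrite subsetD => /andP[_ /setDidPl->].
Qed.

Lemma card_composition g :
  #|{: composition n}| = 2 ^ (#|desc g| + #|desc (compl g)|).
Proof.
rewrite desc_compl -[X in (X + _)%N](@eq_card _ ([set i : 'I_n | 0 < i] :&: desc g)).
  rewrite cardsID -card_powerset -(card_imset _ desc_inj); apply: eq_card => S.
  rewrite powersetE; apply/imsetP/idP => [[a _ ->]|]; first exact: desc_sub.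
  by case/desc_onto => a <-; exists a.
by apply/setP/setIidPr/desc_sub.
Qed.

End DescentBijection.

Local Open Scope ring_scope.

Notation Cqt R := {fraction {poly {poly complex R}}}.

Section Sym.
Variable R : realType.

(* C(q,t) is built as the fractions of C[q][t]: the outer variable is t. *)
Definition qpar : Cqt R := tofrac ('X%:P).
Definition tpar : Cqt R := tofrac 'X.

(* The letter i : nat stands for the generator h_(i+1). *)
Definition Sym := {malg (Cqt R)[{fmonom nat}]}.

HB.instance Definition _ := GRing.Lalgebra.on Sym.
Definition hgen (k : nat) : Sym := << fmu k.-1 >>.

Section Degree.
Variable n : nat.
Implicit Types a b g : composition n.

Definition hcomp a : Sym := \prod_(k <- a) hgen k.

Definition ribbon a : Sym :=
  \sum_(b | finer a b) (-1) ^+ (size a - size b) *: hcomp b.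

Definition macdonald a : Sym :=
  \sum_b (tpar ^+ cstat a b * qpar ^+ cstat (conj_comp a) (rev_comp b))
    *: ribbon b.

(* t is an argument, to be instantiated with the inverse of tpar. *)
Definition gribbon (t : Cqt R) g a : Sym :=
  \sum_(b | finer a b && (desc a :\: desc b \subset desc g))
    t ^+ cstat a (compl b) *: ribbon b.

Definition is_natpoly (x : Cqt R) : Prop :=
  exists2 p : {poly {poly complex R}},
    (forall i j, exists m : nat, p`_i`_j = m%:R) & x = tofrac p.

Definition ribbon_positive_up_to_sign (x : Sym) : Prop :=
  exists (s : bool) (c : composition n -> Cqt R),
    (forall b, is_natpoly (c b)) /\ (-1) ^+ s *: x = \sum_b c b *: ribbon b.

(* tensmx B C is [b_ij C]; the convention here is B (x) C = [c_ij B], that is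
   tensmx C B.  Hence in bigtens the head of the list is the fastest index. *)
Definition anymx := {d : nat * nat & 'M[Cqt R]_(d.1, d.2)}.

Definition anymx_of r c (A : 'M[Cqt R]_(r, c)) : anymx := existT _ (r, c) A.

Fixpoint tens_rows (As : seq anymx) : nat :=
  if As is A :: As' then (tens_rows As' * (tag A).1)%N else 1%N.

Fixpoint tens_cols (As : seq anymx) : nat :=
  if As is A :: As' then (tens_cols As' * (tag A).2)%N else 1%N.

Fixpoint bigtens (As : seq anymx) : 'M[Cqt R]_(tens_rows As, tens_cols As) :=
  match As with
  | [::] => 1%:M
  | A :: As' => tensmx (bigtens As') (tagged A)
  end.

Definition factor_in (i : nat) : 'M[Cqt R]_(1, 2) :=
  \row_j [:: 1; tpar ^+ i]`_j.

Definition factor_out (i : nat) : 'M[Cqt R]_2 :=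
  \matrix_(r, c)
    (nth [::] [:: [:: 0; - (qpar ^+ (n - i) * tpar ^+ i)];
                  [:: 1; tpar ^+ i + qpar ^+ (n - i)]] r)`_c.

Definition factors g : seq anymx :=
  [seq anymx_of (factor_in i) | i : 'I_n <- enum (desc g)] ++
  [seq anymx_of (factor_out i)
     | i : 'I_n <- enum ([set i : 'I_n | (0 < i)%N] :\: desc g)].

Definition finer_by_phi g := by_phi g [pred a | finer a g].
Definition all_by_phi g := by_phi g (@predT (composition n)).

Lemma tens_rows_factors g : tens_rows (factors g) = size (finer_by_phi g).
Proof.
rewrite size_sort -cardE card_finer desc_compl cardE /factors.
elim: (enum (desc g)) => [|i s IH] /=; last by rewrite muln1.
by elim: (enum _) => //= i s ->; rewrite expnSr.
Qed.

Lemma tens_cols_factors g : tens_cols (factors g) = size (all_by_phi g).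
Proof.
rewrite size_sort -cardE (card_composition g) desc_compl !cardE /factors.
elim: (enum (desc g)) => [|i s IH] /=; last by rewrite IH addSn expnSr.
by elim: (enum _) => //= i s ->; rewrite !add0n expnSr.
Qed.

Definition nabla_matrix g : 'M[Cqt R]_(size (finer_by_phi g), size (all_by_phi g)) :=
  castmx (tens_rows_factors g, tens_cols_factors g) (bigtens (factors g)).

Definition colvec (s : seq (composition n)) (F : composition n -> Sym) :
  'cV[Sym]_(size s) := \col_i F (tnth (in_tuple s) i).

End Degree.

(* Together with linearity this determines nabla, as the macdonald a, for all n
   and all compositions a of n, form a basis of Sym. *)
Definition is_nabla (nabla : Sym -> Sym) : Prop :=
  forall n (a : composition n), nabla (macdonald a) =
    (tpar ^+ nstat a * qpar ^+ nstat (conj_comp a)) *: macdonald a.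

End Sym.

(* Main.v *)
(* Identify a composition with its descent set, a subset of {1, ..., n-1}, so
   that degree n is a tensor product of n-1 planes, one per index i, each with
   basis (R_0, R_1) recording whether i is a descent. Macdonald polynomials,
   gamma-Schur functions and nabla all factor over i. With a = q^(n-i) and
   b = t^i, the i-th factors are H_0 = R_0 + a R_1 and H_1 = R_0 + b R_1, with
   eigenvalues a and b; hence nabla sends R_0 to -ab R_1 and R_1 to
   R_0 + (a + b) R_1. For i in D(gamma), R_1 + R_0 / b is sent to R_0 + b R_1,
   where the negative contribution cancels; for the other i each of the two images
   has coefficients of a single sign, whence the global sign. *)
Require Import Defs.
From HB Require Import structures.
From mathcomp Require Import all_boot all_order all_algebra.
From mathcomp Require Import reals.
From mathcomp Require Import complex mxtens ring zify.

Set Implicit Arguments.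
Unset Strict Implicit.
Unset Printing Implicit Defensive.

Import GRing.Theory.
Local Open Scope ring_scope.

(** * Descents and statistics under reversal and complement *)

Section Statistics.
Variable n : nat.
Implicit Types (a b : composition n) (i : 'I_n) (A B C : {set 'I_n}).

(* The fallback value i is only taken at i = 0, where n - i is not below n. *)
Definition flip i : 'I_n := insubd i (n - i)%N.

Lemma val_flip i : (0 < i)%N -> flip i = (n - i)%N :> nat.
Proof.
move=> i0; have lt_in := ltn_ord i.
by rewrite val_insubd ltn_subrL i0 (leq_ltn_trans _ lt_in).
Qed.

Lemma flip0 i : i = 0%N :> nat -> flip i = i.
Proof. by move=> i0; apply: val_inj; rewrite val_insubd i0 subn0 ltnn. Qed.

Lemma flip_gt0 i : (0 < flip i)%N = (0 < i)%N.
Proof.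
by case: (posnP i) => [i0|i0]; [rewrite flip0 // i0 | rewrite val_flip // subn_gt0 ltn_ord].
Qed.

Lemma flipK : involutive flip.
Proof.
move=> i; case: (posnP i) => [i0|i0]; first by rewrite !flip0.
by apply: val_inj; rewrite /= val_flip ?flip_gt0 // val_flip // subKn // ltnW.
Qed.

(** A prefix of the reversed word is a reversed suffix of [a]; the complementary prefix of [a] then
    sums to n - i. *)
Lemma desc_rev_sub a i : i \in desc (rev_comp a) -> flip i \in desc a.
Proof.
move=> i_ra; have i0 := desc_pos i_ra; move: i_ra.
rewrite !inE => /existsP[/= k /andP[k0 /eqP Ei]].
have lt_k : (k < size a)%N by rewrite -[X in (_ < X)%N]size_rev.
have lt_k' : (size a - k < size a)%N by rewrite ltn_subrL k0 (leq_ltn_trans _ lt_k).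
apply/existsP; exists (Ordinal lt_k'); rewrite /= subn_gt0 lt_k val_flip //=.
have /andP[_ /eqP sum_a] := valP a.
have : sumn (take (size a - k) a ++ drop (size a - k) a) = n by rewrite cat_take_drop.
rewrite sumn_cat => sum_td; apply/eqP/(canLR (addnK _)).
by rewrite Ei take_rev sumn_rev sum_td.
Qed.

Lemma desc_rev a i : (i \in desc (rev_comp a)) = (flip i \in desc a).
Proof.
apply/idP/idP => [/desc_rev_sub //|fi].
have -> : i = flip (flip i) by rewrite flipK.
have rr : rev_comp (rev_comp a) = a by apply: val_inj; rewrite /= revK.
by apply: desc_rev_sub; rewrite rr.
Qed.

Lemma mem_desc_compl a i : (i \in desc (compl a)) = (0 < i)%N && (i \notin desc a).
Proof. by rewrite desc_compl !inE andbC. Qed.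

(** Reindexing by [flip] undoes the reversal in the conjugate and turns the weight i into n - i:
    this is where the exponents n - i of q come from. *)
Lemma nstat_conj a :
  nstat (conj_comp a) = (\sum_(i : 'I_n | (0 < i) && (i \notin desc a)) (n - i))%N.
Proof.
rewrite /nstat (reindex_inj (inv_inj flipK)).
apply: eq_big => i; rewrite desc_rev flipK mem_desc_compl // => /andP[i0 _].
by rewrite val_flip.
Qed.

Lemma cstat_conj a b : cstat (conj_comp a) (rev_comp b) =
  (\sum_(i : 'I_n | [&& 0 < i, i \notin desc a & i \in desc b]) (n - i))%N.
Proof.
rewrite /cstat (reindex_inj (inv_inj flipK)).
apply: eq_big => i; rewrite in_setI !desc_rev !flipK mem_desc_compl -?andbA //.
by case/andP=> i0 _; rewrite val_flip.
Qed.

Lemma cstat_compl a b :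
  cstat a (compl b) = (\sum_(i in desc a :\: desc b) i)%N.
Proof.
apply: eq_bigl => i; rewrite in_setI in_setD mem_desc_compl andbC.
by case: (boolP (i \in desc a)) => [/desc_pos->|_]; rewrite ?andbF ?andbT.
Qed.

End Statistics.

(** * Tensor products of 2 by 2 matrices, indexed by subsets *)

Section TensorProducts.
Variables (F : comPzRingType) (n : nat).
Implicit Types (x y : 'I_n -> bool -> bool -> F) (A B C : {set 'I_n}).

(** Entry in row [A] and column [B] of the tensor product of the 2 by 2 matrices [x i]. *)
Definition tprod x A B : F := \prod_(i : 'I_n | (0 < i)%N) x i (i \in A) (i \in B).

Lemma eq_tprod x y A B :
  (forall i : 'I_n, (0 < i)%N ->
     x i (i \in A) (i \in B) = y i (i \in A) (i \in B)) ->
  tprod x A B = tprod y A B.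
Proof. by move=> xy; apply: eq_bigr => i; apply: xy. Qed.

Lemma desc_imset : [set desc a | a : composition n] = powerset [set i : 'I_n | (0 < i)%N].
Proof.
apply/setP => A; rewrite powersetE; apply/imsetP/idP => [[a _ ->]|/desc_onto[a <-]].
  exact: desc_sub.
by exists a.
Qed.

(* The index 0 of 'I_n is never a descent: f0 and f1 below remove it from the
   sum over all subsets. *)
Lemma sum_prod_desc (f : 'I_n -> bool -> F) :
  \sum_(a : composition n) \prod_(i : 'I_n | (0 < i)%N) f i (i \in desc a) =
  \prod_(i : 'I_n | (0 < i)%N) (f i true + f i false).
Proof.
transitivity (\sum_(A in powerset [set i : 'I_n | (0 < i)%N])
    \prod_(i : 'I_n | (0 < i)%N) f i (i \in A)).
  by rewrite -desc_imset big_imset // => a b _ _ /desc_inj.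
pose f1 (i : 'I_n) := if (0 < i)%N then f i true else 0.
pose f0 (i : 'I_n) := if (0 < i)%N then f i false else 1.
rewrite [RHS]big_mkcond (eq_bigr (fun i => f1 i + f0 i)) /=; last first.
  by move=> i _; rewrite /f1 /f0; case: ifP; rewrite ?add0r.
rewrite bigA_distr [RHS](bigID (mem (powerset [set i : 'I_n | (0 < i)%N]))) /=.
rewrite [X in _ = _ + X]big1 ?addr0 => [|A].
  apply: eq_bigr => A; rewrite powersetE => /subsetP sA.
  rewrite big_mkcond; apply: eq_bigr => i _; rewrite /f1 /f0.
  case: (boolP (i \in A)) => [/sA|_]; last by case: ifP.
  by rewrite inE => ->.
rewrite powersetE => /subsetPn[i iA i0].
rewrite (bigD1 i) //= iA /f1; case: ifP i0; rewrite ?mul0r // inE => ->.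
by [].
Qed.

(** The mixed-product rule: tensor products multiply factor by factor, because descent sets run
    through all subsets of the positive indices. *)
Lemma sum_tprod x y A C :
  \sum_(b : composition n) tprod x A (desc b) * tprod y (desc b) C =
  tprod (fun i r c => x i r true * y i true c + x i r false * y i false c) A C.
Proof.
rewrite /tprod -(sum_prod_desc (fun i b => x i (i \in A) b * y i b (i \in C))).
by apply: eq_bigr => b _; rewrite -big_split.
Qed.

(** The product does not see index 0, so [A] and [B] have to avoid it for their equality to be
    detected. *)
Lemma tprod_id A B :
  A \subset [set i : 'I_n | (0 < i)%N] ->
  B \subset [set i : 'I_n | (0 < i)%N] ->
  tprod (fun _ r c => (r == c)%:R) A B = (A == B)%:R.
Proof.
move=> /subsetP sA /subsetP sB; case: eqP => [->|neqAB].
  by rewrite /tprod big1 // => i _; rewrite eqxx.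
have /existsP[i neq_i] : [exists i, (i \in A) != (i \in B)].
  apply: contraT; rewrite negb_exists => /forallP eqAB.
  by case: neqAB; apply/setP => i; apply/eqP; rewrite -[_ == _]negbK eqAB.
have i0 : (0 < i)%N.
  case iA: (i \in A); first by move: (sA i iA); rewrite inE.
  by move: neq_i (sB i); rewrite iA; case: (i \in B) => // _ /(_ isT); rewrite inE.
by rewrite /tprod (bigD1 i) //= (negbTE neq_i) mul0r.
Qed.

End TensorProducts.

(** * The 2 by 2 factors of the changes of basis and of nabla *)

Section Factors.
Variables (F : fieldType) (n : nat) (q t : F).
Implicit Types (a b c g : composition n) (i : 'I_n).

(* In the factors below, r and c tell whether i is a descent of the row and of
   the column composition. *)
Definition eigen_factor i (r : bool) : F := if r then t ^+ i else q ^+ (n - i).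

Definition macdonald_factor i (r c : bool) : F := if c then eigen_factor i r else 1.

(** Adjugate over determinant for the matrix with rows (1, a) and (1, b), where a = q^(n-i) and b =
    t^i; the determinant is b - a. *)
Definition macdonald_inv_factor i (r c : bool) : F :=
  (-1) ^+ (r (+) c) * (if r then 1 else eigen_factor i (~~ c))
    / (eigen_factor i true - eigen_factor i false).

(** A companion matrix of (X - a)(X - b), for the same a and b. *)
Definition nabla_factor i (r c : bool) : F :=
  if r then (if c then t ^+ i + q ^+ (n - i) else 1)
  else (if c then - (q ^+ (n - i) * t ^+ i) else 0).

(** The zeros encode the range of summation: a descent gained in the column violates refinement, and
    one lost outside D(gamma) violates the second condition. *)
Definition gribbon_factor g i (r c : bool) : F :=
  if r == c then 1 else if r && (i \in desc g) then t^-1 ^+ i else 0.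

(** For i in D(gamma) the row bit is always true when [finer a g], which leaves the single row of a
    1 by 2 factor. *)
Definition gribbon_nabla_factor g i (r c : bool) : F :=
  if i \in desc g then (if c then t ^+ i else 1) else nabla_factor i r c.

Lemma eigen_tprod a :
  t ^+ nstat a * q ^+ nstat (conj_comp a) =
  \prod_(i : 'I_n | (0 < i)%N) eigen_factor i (i \in desc a).
Proof.
rewrite nstat_conj /nstat !expr_sum [RHS](bigID (mem (desc a))) /=; congr (_ * _).
  apply: eq_big => [i|i ia]; last by rewrite /eigen_factor ia.
  by apply/idP/andP => [ia|[]//]; rewrite (desc_pos ia).
by apply: eq_bigr => i /andP[_ /negbTE ia]; rewrite /eigen_factor ia.
Qed.

Lemma macdonald_coef a b :
  t ^+ cstat a b * q ^+ cstat (conj_comp a) (rev_comp b) =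
  tprod macdonald_factor (desc a) (desc b).
Proof.
rewrite cstat_conj /cstat !expr_sum /tprod [RHS](bigID (mem (desc b))) /=.
rewrite [X in _ = _ * X]big1 ?mulr1; last first.
  by move=> i /andP[_ /negbTE ib]; rewrite /macdonald_factor ib.
rewrite [RHS](bigID (mem (desc a))) /=; congr (_ * _).
  apply: eq_big => [i|i]; last first.
    by rewrite in_setI /macdonald_factor => /andP[-> ->].
  rewrite in_setI [RHS]andbC; case: (boolP (i \in desc a)) => //= ia.
  by rewrite (desc_pos ia).
apply: eq_big => i; first by rewrite -andbA; congr andb; rewrite andbC.
by case/and3P=> _ /negbTE ia ib; rewrite /macdonald_factor ia ib.
Qed.

Lemma gribbon_coef g a b :
  tprod (gribbon_factor g) (desc a) (desc b) =
  if finer a b && (desc a :\: desc b \subset desc g)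
  then t^-1 ^+ cstat a (compl b) else 0.
Proof.
case: ifP => [/andP[/subsetP ba /subsetP abg]|].
  rewrite cstat_compl expr_sum /tprod big_mkcond [RHS]big_mkcond.
  apply: eq_bigr => i _; move: (ba i) (abg i) (@desc_pos _ a i).
  rewrite /gribbon_factor !in_setD.
  case: (i \in desc a); case: (i \in desc b) => /= h1 h2 h3; rewrite ?if_same //.
    by rewrite h2 // h3.
  by have := h1 isT.
move/negbT; rewrite negb_and /finer => not_ab.
have [i i0 zi] : exists2 i : 'I_n, (0 < i)%N &
    gribbon_factor g i (i \in desc a) (i \in desc b) = 0.
  rewrite /gribbon_factor; case/orP: not_ab => [/subsetPn[i ib]|/subsetPn[i iab]].
    by move=> /negbTE ia; exists i; rewrite ?ia ?ib // (desc_pos ib).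
  move: iab; rewrite in_setD => /andP[/negbTE ib ia] /negbTE ig.
  by exists i; rewrite ?ia ?ib ?ig // (desc_pos ia).
by rewrite /tprod (bigD1 i) //= zi mul0r.
Qed.

(** Composing two expansions multiplies their tensor matrices, so each change of basis below reduces
    to 2 by 2 identities. *)
Lemma sum_tprod_scale (V : lmodType F) (x y : 'I_n -> bool -> bool -> F)
    (A : {set 'I_n}) (v : composition n -> V) :
  \sum_b tprod x A (desc b) *: (\sum_c tprod y (desc b) (desc c) *: v c) =
  \sum_c tprod (fun i (r c : bool) => x i r true * y i true c + x i r false * y i false c)
    A (desc c) *: v c.
Proof.
under eq_bigr => b _ do rewrite scaler_sumr.
rewrite exchange_big; apply: eq_bigr => c _ /=.
rewrite -sum_tprod scaler_suml; apply: eq_bigr => b _.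
by rewrite scalerA.
Qed.

Lemma gribbon_tprod (V : lmodType F) (v : composition n -> V) g a :
  \sum_(b | finer a b && (desc a :\: desc b \subset desc g))
    t^-1 ^+ cstat a (compl b) *: v b =
  \sum_b tprod (gribbon_factor g) (desc a) (desc b) *: v b.
Proof.
rewrite big_mkcond; apply: eq_bigr => b _.
by rewrite gribbon_coef; case: ifP => _; rewrite ?scale0r.
Qed.

Lemma macdonald_inv_tprod (V : lmodType F) (v : composition n -> V) a :
  (forall i, (0 < i)%N -> t ^+ i != q ^+ (n - i)) ->
  \sum_b tprod macdonald_inv_factor (desc a) (desc b) *:
    (\sum_c tprod macdonald_factor (desc b) (desc c) *: v c) = v a.
Proof.
move=> tq; rewrite sum_tprod_scale.
transitivity (\sum_c tprod (fun _ (r c : bool) => (r == c)%:R : F) (desc a) (desc c) *: v c).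
  apply: eq_bigr => c _; congr (_ *: _); apply: eq_tprod => i /tq.
  rewrite -subr_eq0 /macdonald_inv_factor /macdonald_factor /eigen_factor.
  by case: (i \in desc a); case: (i \in desc c) => /= nz; field.
rewrite (bigD1 a) //= tprod_id ?desc_sub // eqxx scale1r big1 ?addr0 // => b neq_ba.
by rewrite tprod_id ?desc_sub // (inj_eq (@desc_inj n)) eq_sym (negbTE neq_ba) scale0r.
Qed.

(** Inverse expansion, scaling by eigenvalues and expansion conjugate diag(a, b) in each factor,
    which yields the companion matrix. The hypothesis makes b - a invertible. *)
Lemma nabla_tprod (V : lmodType F) (v : composition n -> V) a :
  (forall i, (0 < i)%N -> t ^+ i != q ^+ (n - i)) ->
  \sum_b (tprod macdonald_inv_factor (desc a) (desc b) *
           (t ^+ nstat b * q ^+ nstat (conj_comp b))) *: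
    (\sum_c tprod macdonald_factor (desc b) (desc c) *: v c) =
  \sum_c tprod nabla_factor (desc a) (desc c) *: v c.
Proof.
move=> tq.
transitivity (\sum_b
  tprod (fun i (r c : bool) => macdonald_inv_factor i r c * eigen_factor i c) (desc a) (desc b) *:
    (\sum_c tprod macdonald_factor (desc b) (desc c) *: v c)).
  by apply: eq_bigr => b _; rewrite eigen_tprod -big_split.
rewrite sum_tprod_scale.
apply: eq_bigr => c _; congr (_ *: _); apply: eq_tprod => i /tq.
rewrite -subr_eq0 /macdonald_inv_factor /macdonald_factor /eigen_factor /nabla_factor.
by case: (i \in desc a); case: (i \in desc c) => /= nz; field.
Qed.

Lemma gribbon_nabla_tprod (V : lmodType F) (v : composition n -> V) g a :
  t != 0 -> finer a g ->
  \sum_b tprod (gribbon_factor g) (desc a) (desc b) *: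
    (\sum_c tprod nabla_factor (desc b) (desc c) *: v c) =
  \sum_c tprod (gribbon_nabla_factor g) (desc a) (desc c) *: v c.
Proof.
move=> t0 ag; rewrite sum_tprod_scale.
apply: eq_bigr => c _; congr (_ *: _); apply: eq_tprod => i _.
rewrite /gribbon_factor /gribbon_nabla_factor /nabla_factor.
case: (boolP (i \in desc g)) => [ig|_].
  rewrite (subsetP ag _ ig) /=.
  case: (i \in desc c); rewrite ?mulr0 ?mul1r ?addr0 // exprVn mulrN.
  (* Here t^(-i) times -q^(n-i) t^i leaves -q^(n-i), which cancels the q^(n-i) coming from the other
     row. *)
  rewrite mulrCA mulVf ?expf_neq0 // mulr1; ring.
by case: (i \in desc a); case: (i \in desc c) => /=; rewrite ?mulr0 ?mul1r ?mul0r ?addr0 ?add0r.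
Qed.

End Factors.

(** * The action of nabla on ribbons and gamma-Schur functions *)

Section Nabla.
Variables (R : realType) (n : nat).
Implicit Types (a b c g : composition n) (i : 'I_n).

Local Notation q := (qpar R).
Local Notation t := (tpar R).

(** In the outer variable t, the left side has degree k > 0 and the right side is constant. *)
Lemma tpar_neq_qpar (k l : nat) : (0 < k)%N -> t ^+ k != q ^+ l.
Proof.
move=> k0; rewrite /tpar /qpar -!tofracXn tofrac_eq.
apply/eqP => /(congr1 (fun p : {poly {poly complex R}} => size p)).
rewrite -polyC_exp size_polyXn size_polyC => e.
by move: k0; case: (_ != 0) e => // -[->].
Qed.

Lemma tpar_neq0 : t != 0.
Proof. by rewrite tofrac_eq0 polyX_eq0. Qed.

Lemma macdonaldE a : macdonald R a =
  \sum_b tprod (macdonald_factor q t) (desc a) (desc b) *: ribbon R b.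
Proof. by apply: eq_bigr => b _; rewrite macdonald_coef. Qed.

Lemma gribbonE g a : gribbon t^-1 g a =
  \sum_b tprod (gribbon_factor t g) (desc a) (desc b) *: ribbon R b.
Proof. exact: gribbon_tprod. Qed.

Lemma ribbonE a : ribbon R a =
  \sum_b tprod (macdonald_inv_factor q t) (desc a) (desc b) *: macdonald R b.
Proof.
under eq_bigr => b _ do rewrite macdonaldE.
by rewrite macdonald_inv_tprod // => i; apply: tpar_neq_qpar.
Qed.

Variable nabla : {linear Sym R -> Sym R}.
Hypothesis nablaP : is_nabla nabla.

Lemma nabla_ribbon a : nabla (ribbon R a) =
  \sum_b tprod (nabla_factor q t) (desc a) (desc b) *: ribbon R b.
Proof.
rewrite ribbonE linear_sum /= -nabla_tprod; last by move=> i; apply: tpar_neq_qpar.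
by apply: eq_bigr => b _; rewrite linearZ /= nablaP scalerA macdonaldE.
Qed.

Lemma nabla_gribbon g a : finer a g -> nabla (gribbon t^-1 g a) =
  \sum_b tprod (gribbon_nabla_factor q t g) (desc a) (desc b) *: ribbon R b.
Proof.
move=> ag; rewrite gribbonE linear_sum /= -gribbon_nabla_tprod //; last exact: tpar_neq0.
by apply: eq_bigr => b _; rewrite linearZ /= nabla_ribbon.
Qed.

End Nabla.

(** * Binary codes of sets *)

Section BinaryCode.
Variable T : eqType.
Implicit Types (s : seq T) (A B : pred T).

(** The head is the least significant digit, in agreement with [bigtens], where it is the fastest
    index. *)
Fixpoint code s A : nat := if s is i :: s' then A i + 2 * code s' A else 0.

Lemma code_index s A : uniq s -> code s A = (\sum_(i <- s | A i) 2 ^ index i s)%N.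
Proof.
elim: s => [|i s IH] /=; first by rewrite big_nil.
move=> /andP[i_s us]; rewrite big_cons eqxx {}IH // big_distrr /=.
(* Restoring the head shifts every index in the tail by one; uniqueness excludes j = i. *)
have -> : (\sum_(j <- s | A j) 2 * 2 ^ index j s =
    \sum_(j <- s | A j) 2 ^ (if i == j then 0 else (index j s).+1))%N.
  rewrite big_seq_cond [RHS]big_seq_cond; apply: eq_bigr => j /andP[js _].
  by case: eqP => [ij|_]; [rewrite ij js in i_s | rewrite expnS].
by case: (A i).
Qed.

Lemma code_cat s1 s2 A : code (s1 ++ s2) A = (code s1 A + 2 ^ size s1 * code s2 A)%N.
Proof.
elim: s1 => [|i s IH] /=; first by rewrite mul1n.
by rewrite IH expnS mulnDr mulnA addnA.
Qed.

Lemma code_lt s A : (code s A < 2 ^ size s)%N.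
Proof.
elim: s => //= i s IH; rewrite expnS.
by case: (A i); lia.
Qed.

Lemma code_all s A : all A s -> (code s A).+1 = (2 ^ size s)%N.
Proof. by elim: s => //= i s IH /andP[-> /IH]; rewrite expnS; lia. Qed.

Lemma code_inj s A B : code s A = code s B -> {in s, A =1 B}.
Proof.
elim: s => [|i s IH] //= eq_AB.
have [eq_i /IH eq_s] : A i = B i /\ code s A = code s B.
  by move: eq_AB; case: (A i); case: (B i) => /=; lia.
by move=> j; rewrite inE => /predU1P[->//|]; apply: eq_s.
Qed.

End BinaryCode.

(** Pigeonhole: distinct numbers below their own count fill the whole interval. *)
Lemma sorted_uniq_iota (s : seq nat) : sorted leq s -> uniq s ->
  {in s, forall k, (k < size s)%N} -> s = iota 0 (size s).
Proof.
move=> srt us lt_s; apply: (irr_sorted_eq ltn_trans ltnn).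
- by rewrite ltn_sorted_uniq_leq us.
- exact: iota_ltn_sorted.
- have sub : {subset s <= iota 0 (size s)} by move=> k /lt_s; rewrite mem_iota.
  by have [|_ eq_s] := uniq_min_size us sub; rewrite ?size_iota.
Qed.

(** * Positions in the order by [phi] *)

Section Ordering.
Variables (n : nat) (g : composition n).
Implicit Types (a b : composition n) (i : 'I_n).

(** An injective [f] that orders like [phi g] and stays below the number of elements takes each
    value once, so it reads off the position in the sorted list. *)
Lemma by_phi_code (P : pred (composition n)) (f : composition n -> nat) :
  {in P &, forall a b, (phi g a <= phi g b)%N = (f a <= f b)%N} ->
  {in P &, injective f} -> {in P, forall a, (f a < #|P|)%N} ->
  forall k, f (tnth (in_tuple (by_phi g P)) k) = k :> nat.
Proof.
move=> phi_f inj_f lt_f k; set s := by_phi g P.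
have mem_s a : a \in s -> a \in P by rewrite mem_sort mem_enum.
have size_s : size s = #|P| by rewrite size_sort cardE.
have E : map f s = iota 0 (size (map f s)).
  apply: sorted_uniq_iota.
  - rewrite sorted_map (@eq_in_sorted _ (mem P) _ (fun a b => (phi g a <= phi g b)%N)).
    + by apply: sort_sorted => a b; apply: leq_total.
    + by move=> a b aP bP; rewrite /= phi_f.
    + by apply/allP.
  - rewrite map_inj_in_uniq ?sort_uniq ?enum_uniq // => a b /mem_s aP /mem_s bP.
    exact: inj_f.
  - by move=> _ /mapP[a /mem_s aP ->]; rewrite size_map size_s lt_f.
have lt_k : (k < size s)%N by [].
have a0 : composition n by apply: tnth (in_tuple s) k.
rewrite (tnth_nth a0) -(nth_map _ 0%N) // E size_map nth_iota //.
Qed.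

Definition out_digits : seq 'I_n := enum ([set i : 'I_n | (0 < i)%N] :\: desc g).
Definition digits : seq 'I_n := enum (desc g) ++ out_digits.

Lemma mem_digits i : (i \in digits) = (0 < i)%N.
Proof.
rewrite mem_cat !mem_enum in_setD inE.
by case: (boolP (i \in desc g)) => //= /desc_pos.
Qed.

Lemma digits_uniq : uniq digits.
Proof.
rewrite cat_uniq !enum_uniq andbT; apply/hasPn => i.
by rewrite !mem_enum in_setD => /andP[].
Qed.

(** The list [digits] follows the order of [sigma], so the weights agree. It lacks index 0, which is
    never a descent. *)
Lemma phi_code a : phi g a = code digits (mem (desc a)).
Proof.
rewrite code_index ?digits_uniq // -big_filter big_uniq ?filter_uniq ?digits_uniq //.
rewrite /phi /sigma desc_compl /=; apply: eq_bigl => i.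
rewrite mem_filter mem_digits andbC /=.
by case: (boolP (i \in desc a)) => [/desc_pos->|]; rewrite ?andbF.
Qed.

Lemma phi_inj : injective (phi g).
Proof.
move=> a b; rewrite !phi_code => /code_inj eq_ab; apply: desc_inj; apply/setP => i.
case: (posnP i) => [i0|i0]; last by apply: eq_ab; rewrite mem_digits.
by apply/idP/idP => /desc_pos; rewrite i0.
Qed.

Lemma size_digits : size digits = (#|desc g| + #|desc (compl g)|)%N.
Proof. by rewrite size_cat -!cardE desc_compl. Qed.

Lemma all_by_phi_code k : phi g (tnth (in_tuple (all_by_phi g)) k) = k.
Proof.
apply: by_phi_code => // [a b _ _ /phi_inj //|a _].
by rewrite (card_composition g) -size_digits phi_code code_lt.
Qed.

(* The digits in desc g, which come first, are all 1 when a refines g. *)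
Lemma phi_finer a : finer a g ->
  phi g a = ((2 ^ #|desc g|).-1 + 2 ^ #|desc g| * code out_digits (mem (desc a)))%N.
Proof.
move=> /subsetP ga; rewrite phi_code code_cat -cardE; congr addn.
rewrite cardE -(@code_all _ _ (mem (desc a))) //.
by apply/allP => i; rewrite mem_enum => /ga.
Qed.

(** On refinements of [g], [phi g] is an increasing affine function of the code of the digits
    outside D(gamma), so this shorter code gives the rank. *)
Lemma finer_by_phi_code k :
  code out_digits (mem (desc (tnth (in_tuple (finer_by_phi g)) k))) = k.
Proof.
pose f a := code out_digits (mem (desc a)).
have p2 : (0 < 2 ^ #|desc g|)%N by rewrite expn_gt0.
apply: (@by_phi_code _ f) => [a b|a b|a]; rewrite !inE => ga.
- by move=> gb; rewrite !phi_finer // leq_add2l leq_pmul2l.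
- by move=> gb eq_f; apply: phi_inj; rewrite !phi_finer // -/(f a) eq_f.
- by rewrite card_finer desc_compl cardE code_lt.
Qed.

Lemma finer_tnth k : finer (tnth (in_tuple (finer_by_phi g)) k) g.
Proof. by have := mem_tnth k (in_tuple (finer_by_phi g)); rewrite mem_sort mem_enum. Qed.

End Ordering.

(** * Entries of the iterated tensor product *)

Section TensorEntries.
Variables (R : realType) (n : nat) (g : composition n).
Implicit Types (a b : composition n) (i : 'I_n) (s : seq 'I_n) (A B : {set 'I_n}).

Local Notation q := (qpar R).
Local Notation t := (tpar R).

Local Notation ins s := [seq anymx_of (factor_in R i) | i : 'I_n <- s].
Local Notation outs s := [seq anymx_of (factor_out R n i) | i : 'I_n <- s].

(** Quotient and remainder of an index by 2 separate the tail from the head factor, just as in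
    [code]. *)
Lemma bigtens_out s A B (r : 'I_(tens_rows (outs s))) (c : 'I_(tens_cols (outs s))) :
  r = code s (mem A) :> nat -> c = code s (mem B) :> nat ->
  bigtens (outs s) r c =
  \prod_(i <- s) nabla_factor q t i (i \in A) (i \in B).
Proof.
elim: s r c => [|i s IH] /= r c Er Ec.
  by rewrite big_nil mxE [r]ord1 [c]ord1.
rewrite big_cons mulrC mxE; congr (_ * _).
  by apply: IH => /=; [rewrite Er | rewrite Ec]; case: (i \in _) => /=; lia.
have Er2 : (mxtens_unindex r).2 = (i \in A) :> nat.
  by rewrite /= Er; case: (i \in A) => /=; lia.
have Ec2 : (mxtens_unindex c).2 = (i \in B) :> nat.
  by rewrite /= Ec; case: (i \in B) => /=; lia.
by rewrite mxE Er2 Ec2 /nabla_factor; case: (i \in A); case: (i \in B).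
Qed.

(** The factors of [s1] have a single row, so the row index encodes only [s2], while the column
    index encodes both lists. *)
Lemma bigtens_factors s1 s2 A B (r : 'I_(tens_rows (ins s1 ++ outs s2)))
    (c : 'I_(tens_cols (ins s1 ++ outs s2))) :
  r = code s2 (mem A) :> nat -> c = code (s1 ++ s2) (mem B) :> nat ->
  bigtens (ins s1 ++ outs s2) r c =
  (\prod_(i <- s1) (if i \in B then t ^+ i else 1)) *
  \prod_(i <- s2) nabla_factor q t i (i \in A) (i \in B).
Proof.
elim: s1 r c => [|i s1 IH] /= r c Er Ec; first by rewrite big_nil mul1r (bigtens_out Er Ec).
rewrite big_cons -mulrA mulrC mxE; congr (_ * _).
  by apply: IH; rewrite /= ?Er ?Ec ?divn1 //; case: (i \in _) => /=; lia.
have Ec2 : (mxtens_unindex c).2 = (i \in B) :> nat.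
  by rewrite /= Ec; case: (i \in B) => /=; lia.
by rewrite mxE Ec2; case: (i \in B).
Qed.

Lemma nabla_matrixE k l :
  let a := tnth (in_tuple (finer_by_phi g)) k in
  let b := tnth (in_tuple (all_by_phi g)) l in
  nabla_matrix R g k l = tprod (gribbon_nabla_factor q t g) (desc a) (desc b).
Proof.
move=> a b; rewrite castmxE (@bigtens_factors _ _ (desc a) (desc b)) /=.
- rewrite !big_enum /tprod [RHS](bigID (mem (desc g))) /=; congr (_ * _).
    apply: eq_big => i; last by move=> ig; rewrite /gribbon_nabla_factor ig.
    by case: (boolP (i \in desc g)) => [/desc_pos->|]; rewrite ?andbF.
  apply: eq_big => i; first by rewrite in_setD inE andbC.
  by rewrite in_setD => /andP[/negbTE ig _]; rewrite /gribbon_nabla_factor ig.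
- by rewrite finer_by_phi_code.
- by rewrite -phi_code all_by_phi_code.
Qed.

End TensorEntries.

(** * Polynomials with natural coefficients and the global sign *)

Section Positivity.
Variable R : realType.

Local Notation q := (qpar R).
Local Notation t := (tpar R).

Let coef_nat (p : {poly {poly complex R}}) :=
  forall i j, exists m : nat, p`_i`_j = m%:R.

Let nat_sum (I : Type) (r : seq I) (f : I -> complex R) :
  (forall i, exists m : nat, f i = m%:R) -> exists m : nat, \sum_(i <- r) f i = m%:R.
Proof.
move=> fN; elim/big_ind: _ => [|_ _ [k ->] [l ->]|i _]; last exact: fN.
  by exists 0%N.
by exists (k + l)%N; rewrite natrD.
Qed.

Lemma is_natpoly_nat k : @is_natpoly R k%:R.
Proof.
exists k%:R; last by rewrite rmorph_nat.
move=> i j; rewrite -polyC_natr coefC; case: (i == 0%N); last by exists 0%N; rewrite coef0.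
by rewrite -polyC_natr coefC; case: (j == 0%N); [exists k | exists 0%N].
Qed.

Lemma is_natpoly_add (x y : Cqt R) : is_natpoly x -> is_natpoly y -> is_natpoly (x + y).
Proof.
case=> p pN -> [p' pN' ->]; exists (p + p'); last by rewrite rmorphD.
move=> i j; have [k Ek] := pN i j; have [l El] := pN' i j.
by exists (k + l)%N; rewrite !coefD Ek El natrD.
Qed.

Lemma is_natpoly_mul (x y : Cqt R) : is_natpoly x -> is_natpoly y -> is_natpoly (x * y).
Proof.
case=> p pN -> [p' pN' ->]; exists (p * p'); last by rewrite rmorphM.
move=> i j; rewrite coefM coef_sum; apply: nat_sum => k.
rewrite coefM; apply: nat_sum => l.
have [m1 ->] := pN k l; have [m2 ->] := pN' (i - k)%N (j - l)%N.
by exists (m1 * m2)%N; rewrite natrM.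
Qed.

Lemma is_natpoly_exp (x : Cqt R) k : is_natpoly x -> is_natpoly (x ^+ k).
Proof.
move=> xN; elim: k => [|k IH]; first exact: (is_natpoly_nat 1).
by rewrite exprS; apply: is_natpoly_mul.
Qed.

Lemma is_natpoly_q : is_natpoly q.
Proof.
exists 'X%:P => // i j; rewrite coefC; case: (i == 0%N); last by exists 0%N; rewrite coef0.
by rewrite coefX; exists (j == 1%N).
Qed.

Lemma is_natpoly_t : is_natpoly t.
Proof.
exists 'X => // i j; rewrite coefX; case: (i == 1%N); last by exists 0%N; rewrite coef0.
by rewrite coef1; exists (j == 0%N).
Qed.

Variables (n : nat) (g a : composition n).
Hypothesis ag : finer a g.

(** The sign, independent of [b], gives one -1 to each positive i outside D(a). Such an i is outside
    D(gamma), and its row (0, -q^(n-i) t^i) becomes nonnegative; the other rows already are. *)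
Lemma gribbon_nabla_tprod_natpoly (b : composition n) :
  is_natpoly ((-1) ^+ odd (\sum_(i : 'I_n | (0 < i)%N) (i \notin desc a)) *
    tprod (gribbon_nabla_factor q t g) (desc a) (desc b)).
Proof.
rewrite signr_odd expr_sum -big_split /=.
have tN := is_natpoly_exp _ is_natpoly_t; have qN := is_natpoly_exp _ is_natpoly_q.
apply: big_ind => [||i _]; [exact: (is_natpoly_nat 1) | exact: is_natpoly_mul |].
rewrite /gribbon_nabla_factor /nabla_factor.
case: (boolP (i \in desc g)) => [/(subsetP ag)->|_] /=.
  rewrite mul1r; case: (i \in desc b); [exact: tN | exact: (is_natpoly_nat 1)].
case: (i \in desc a) => /=; case: (i \in desc b).
- by rewrite expr0 mul1r; apply: is_natpoly_add; [exact: tN | exact: qN].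
- by rewrite expr0 mul1r; exact: (is_natpoly_nat 1).
- by rewrite expr1 mulN1r opprK; apply: is_natpoly_mul; [exact: qN | exact: tN].
- by rewrite mulr0; exact: (is_natpoly_nat 0).
Qed.

End Positivity.

Theorem theorem26 (R : realType) (nabla : {linear Sym R -> Sym R})
    (nablaP : is_nabla nabla) (n : nat) (g : composition n) :
  (forall a : composition n, finer a g ->
     ribbon_positive_up_to_sign n (nabla (gribbon (tpar R)^-1 g a))) /\
  map_mx nabla (colvec (finer_by_phi g) (gribbon (tpar R)^-1 g)) =
    map_mx (GRing.in_alg (Sym R)) (nabla_matrix R g)
      *m colvec (all_by_phi g) (@ribbon R n).
Proof.
split=> [a ag|].
  exists (odd (\sum_(i : 'I_n | (0 < i)%N) (i \notin desc a))).
  exists (fun b => (-1) ^+ odd (\sum_(i : 'I_n | (0 < i)%N) (i \notin desc a)) *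
    tprod (gribbon_nabla_factor (qpar R) (tpar R) g) (desc a) (desc b)).
  split=> [b|]; first exact: gribbon_nabla_tprod_natpoly.
  rewrite nabla_gribbon // scaler_sumr.
  by apply: eq_bigr => b _; rewrite scalerA.
apply/colP => k; rewrite !mxE nabla_gribbon ?finer_tnth //.
(* Sorting only permutes the compositions, so the sum may follow the column order of the matrix. *)
transitivity (\sum_(b <- all_by_phi g)
  tprod (gribbon_nabla_factor (qpar R) (tpar R) g)
    (desc (tnth (in_tuple (finer_by_phi g)) k)) (desc b) *: ribbon R b).
  by rewrite (perm_big _ (permEl (perm_sort _ _))) big_enum.
rewrite big_tnth; apply: eq_bigr => l _.
by rewrite !mxE nabla_matrixE mulr_algl.
Qed.
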